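(* Let $0<R\le\infty$, and suppose that $F$ is a cumulative distribution function on $\mathbb{R}$ whose characteristic function $f(t)$ is analytic for $|t|<R$. Then for any $A>0$ and arbitrary $s\in(0,R)$ the following inequality holds: $$1-F(A)+F(-A)\le \frac{\displaystyle\int_0^s\Bigl(\frac{f(iu)+f(-iu)}{2}-1\Bigr)du}{s\,\bigl(\sinh(As)/(As)-1\bigr)}.$$
   Context: The characteristic function of a distribution function $F$ is $f(t)=\int_{-\infty}^{\infty}e^{itx}\,dF(x)$, $t\in\mathbb{R}$. ''Analytic for $|t|<R$'' means that there is a function analytic in the complex disc $\{t\in\mathbb{C}:|t|<R\}$ (the whole plane if $R=\infty$) which coincides with the characteristic function for real $t$ with $|t|<R$; this (unique) analytic extension is again denoted by $f$, and $f(\pm iu)$ are its values at $\pm iu$. *)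

(* Defs.v *)
From HB Require Import structures.
From mathcomp Require Import all_boot all_order all_algebra.
From mathcomp Require Import all_classical all_reals all_analysis.
From mathcomp Require Import complex.

Set Implicit Arguments.
Unset Strict Implicit.
Unset Printing Implicit Defensive.

Import Order.TTheory GRing.Theory Num.Theory.
Import numFieldNormedType.Exports.

Local Open Scope classical_set_scope.
Local Open Scope complex_scope.
Local Open Scope ring_scope.

Definition sinh (R : realType) (x : R) : R := (expR x - expR (- x)) / 2.

(* e^{iy} for real y, by Euler's formula. *)
Definition expi (R : realType) (y : R) : R[i] := cos y +i* sin y.

(* Lebesgue integral of a complex-valued function, taken componentwise.  In
   the order of R[i], z <= w means that z and w have the same imaginary part and
   ordered real parts, so bounding a real number by such an integral also says
   that the integral is real. *)
Definition cintegral d (T : measurableType d) (R : realType)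
    (mu : {measure set T -> \bar R}) (D : set T) (h : T -> R[i]) : R[i] :=
  (\int[mu]_(x in D) complex.Re (h x)) +i* (\int[mu]_(x in D) complex.Im (h x)).

(* [cumulativeBounded 0 1] is the library's type of nondecreasing,
   right-continuous functions with limits 0 at -oo and 1 at +oo, i.e.
   F x = P (X <= x). *)
Definition charf (R : realType) (F : cumulativeBounded (0 : R) (1 : R))
    (t : R) : R[i] :=
  cintegral (lebesgue_stieltjes_measure F) setT (fun x => expi (t * x)).

Definition cdisc (R : realType) (z0 : R[i]) (r : \bar R) : set R[i] :=
  [set z | ((Normc.normc (z - z0))%:E < r)%E].

(* Analyticity in the Weierstrass sense: near every point of D, f is the sum of
   a convergent power series centred at that point. *)
Definition analytic_on (R : realType) (D : set R[i]) (f : R[i] -> R[i]) :=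
  forall z0, D z0 ->
    exists (a : nat -> R[i]) (r : R), 0 < r /\
      forall z, cdisc z0 r%:E z ->
        series (fun n => a n * (z - z0) ^+ n : (R[i])^o) @ \oo --> (f z : (R[i])^o).

(* Main.v *)
(** Write [h u = (f(iu) + f(-iu)) / 2] and let [X] have distribution function
    [F].  The point is that [h u] is the (finite) expectation of [cosh (u X)]
    for every [u] in [[0, rho)].  Granting this, [cosh (u x) >= cosh (u A)] when
    [|x| >= A] and [cosh >= 1] give
    [h u - 1 >= (cosh (u A) - 1) (1 - F A + F (-A))], and integrating over
    [[0, s]] yields the theorem, since the integral of [cosh (u A) - 1] is
    [sinh (A s) / A - s].

    The identity is propagated along the imaginary axis, using only power series
    at the points [ib] and [-ib].  If the expectation of a function of [v] whose Taylor
    remainders at [0] alternate in sign is the sum of a power series for small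
    [v > 0], Fatou's lemma shows, coefficient by coefficient, that expectation
    and expansion commute.  Near [0] this applies to [1 + cos (sqrt v X)] and
    identifies the moments of [X].  If the identity holds on [[0, b)], it applies
    to [cosh ((b - v) X)]; changing the sign of [v] turns the expansion into one
    with nonnegative terms, so it can be summed inside the expectation, and the
    identity holds slightly beyond [b]. *)

Require Import Defs.
From HB Require Import structures.
From mathcomp Require Import all_boot all_order all_algebra.
From mathcomp Require Import all_classical all_reals all_analysis.
From mathcomp Require Import measurable_realfun complex.
From mathcomp Require Import ring lra.

Set Implicit Arguments.
Unset Strict Implicit.
Unset Printing Implicit Defensive.

Import Order.TTheory GRing.Theory Num.Theory.
Import numFieldNormedType.Exports.

Local Open Scope classical_set_scope.
Local Open Scope complex_scope.
Local Open Scope ring_scope.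

(** * Sign of alternating Taylor remainders *)

Lemma ge0_of_derive_ge0 (R : realType) (f df : R -> R) (b : R) :
  (forall x : R, is_derive x 1 f (df x)) ->
  (forall x, 0 <= x -> x <= b -> 0 <= df x) -> f 0 = 0 ->
  forall x, 0 <= x -> x <= b -> 0 <= f x.
Proof.
move=> f_df df_ge0 f0 x x0 xb.
have cf : {within `[0, x], continuous f}.
  apply: continuous_subspaceT => y.
  by apply/differentiable_continuous/derivable1_diffP; have [] := f_df y.
have [c cx fE] := MVT_segment x0 (fun y _ => f_df y) cf.
have /andP[c0 cx'] : 0 <= c <= x by move: cx; rewrite in_itv.
have : 0 <= f x - f 0 by rewrite fE subr0 mulr_ge0 ?df_ge0 // (le_trans cx').
by rewrite f0 subr0.
Qed.

(* Signed remainder after [n] terms of the expansion of [l] as the sum of the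
   [(-1)^j a_j]. *)
Definition altrem {R : realType} (a : nat -> R) (l : R) (n : nat) : R :=
  (-1) ^+ n * (l - \sum_(0 <= j < n) (-1) ^+ j * a j).

Lemma altrem0 (R : realType) (a : nat -> R) l : altrem a l 0 = l.
Proof. by rewrite /altrem big_nil subr0 mul1r. Qed.

Lemma altremS (R : realType) (a : nat -> R) l n :
  altrem a l n.+1 = a n - altrem a l n.
Proof.
rewrite /altrem big_nat_recr //= exprS.
have : ((-1) ^+ n * (-1) ^+ n = 1 :> R) by rewrite -exprD addnn -mul2n exprM sqrrN expr1n expr1n.
set e := (-1) ^+ n; set S := \sum_(_ <= _ < _) _ => ee.
transitivity (- (e * (l - S)) + (e * e) * a n); first by ring.
by rewrite ee mul1r addrC.
Qed.

(** Induction on the order, for all [D p] at once: the remainder of order [n.+1] of [D p] vanishes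
    at 0, and its derivative is the remainder of order [n] of [D p.+1], the sign of the derivative
    being absorbed by the factor [(-1) ^+ n.+1]. *)
Lemma completely_monotone_altrem_ge0 (R : realType) (D : nat -> R -> R) (b : R) :
  (forall p (v : R), is_derive v 1 (D p) (- D p.+1 v)) ->
  (forall p v, 0 <= v -> v <= b -> 0 <= D p v) ->
  forall n v, 0 <= v -> v <= b ->
    0 <= altrem (fun j => D j 0 * v ^+ j / j`!%:R) (D 0%N v) n.
Proof.
move=> dD D0 n.
suff H p v : 0 <= v -> v <= b ->
    0 <= altrem (fun j => D (p + j)%N 0 * v ^+ j / j`!%:R) (D p v) n.
  by move=> v; exact: (H 0%N).
elim: n p v => [|n IHn] p v v0 vb; first by rewrite altrem0 D0.
pose E v := altrem (fun j => D (p + j)%N 0 * v ^+ j / j`!%:R) (D p v) n.+1.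
pose dE v := altrem (fun j => D (p.+1 + j)%N 0 * v ^+ j / j`!%:R) (D p.+1 v) n.
apply: (@ge0_of_derive_ge0 _ E dE b) => // [x|x x0 xb|]; last first.
- rewrite /E /altrem big_nat_recl //= big1 => [|i _].
    by rewrite addn0 expr0 !mul1r fact0 divr1 mulr1 addr0 subrr mulr0.
  by rewrite expr0n /= mulr0 mul0r mulr0.
- exact: IHn.
(* The term of index 0 is constant and is split off; the term of index [i.+1] differentiates to one
   of index [i]. *)
pose q i (y : R) := (-1) ^+ i.+1 * (D (p + i.+1)%N 0 * y ^+ i.+1 / i.+1`!%:R).
have -> : E = (-1) ^+ n.+1 *: (D p - (cst (D p 0) + \sum_(i < n) q i)).
  apply/funext => y; rewrite /E /altrem big_nat_recl //= big_mkord.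
  rewrite addn0 expr0 fact0 divr1 mulr1 mul1r.
  by rewrite /GRing.scale /= !fctE fct_sumE.
have dq (i : 'I_n) : is_derive x 1 (q i)
    ((-1) ^+ i.+1 * (D (p + i.+1)%N 0 * x ^+ i / i`!%:R)).
  have -> : q i = ((-1) ^+ i.+1 * (D (p + i.+1)%N 0 / (i.+1)`!%:R)) \*: (@id R ^+ i.+1).
    apply/funext => y; rewrite /q exprfctE /GRing.scale /=.
    by rewrite -[RHS]mulrA; congr (_ * _); exact: mulrAC.
  apply: is_derive_eq; rewrite /GRing.scale /= factS natrM.
  have h1 : i.+1%:R != 0 :> R by rewrite pnatr_eq0.
  have h2 : i`!%:R != 0 :> R by rewrite pnatr_eq0 -lt0n fact_gt0.
  move: (i.+1%:R : R) (i`!%:R : R) h1 h2 => a d a0 d0.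
  by rewrite mulr1; field; rewrite a0 d0.
have dDp : is_derive x 1 (D p) (- D p.+1 x) by exact: dD.
have ds : is_derive x 1 (\sum_(i < n) q i) _ := is_derive_sum dq.
have dB := is_deriveB dDp (is_deriveD (is_derive_cst (D p 0) x 1) ds).
have := is_deriveZ ((-1) ^+ n.+1) dB.
move/is_derive_eq; apply.
rewrite /dE /altrem /GRing.scale /= add0r big_mkord exprS.
rewrite mulN1r mulNr -mulrN opprB opprK [X in _ * X]addrC -sumrN.
congr (_ * (_ + _)); apply: eq_bigr => i _.
by rewrite exprS addSnnS mulN1r mulNr.
Qed.

(** * Power series and integrals *)

(** Convergence at [r / 2] bounds the terms there, so for [v <= r / 4] the tail is dominated by a
    geometric series of ratio at most 1/2. *)
Lemma cvg_series_remainder (R : realType) (c : nat -> R) (g : R -> R) (r : R) :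
  0 < r ->
  (forall v, 0 < v -> v < r -> series (fun j => c j * v ^+ j) @ \oo --> g v) ->
  forall n, exists K, forall v, 0 < v -> v <= r / 4 ->
    `|g v - \sum_(0 <= j < n) c j * v ^+ j| <= K * v ^+ n.
Proof.
move=> r0 cg n.
have r20 : 0 < r / 2 by rewrite divr_gt0.
have r2r : r / 2 < r by rewrite ltr_pdivrMr // mulr_natr mulr2n ltrDl.
have : bounded_fun (fun j => c j * (r / 2) ^+ j).
  by apply: cvg_series_bounded; apply/cvg_ex; exists (g (r / 2)); exact: cg.
have PF : ProperFilter (globally [set: nat]) :=
  globally_properfilter (I : [set: nat] 0%N).
move=> /ex_bound [B HB].

have B0 : 0 <= B := le_trans (normr_ge0 _) (HB 0%N I).
(* [B] bounds the terms at [r / 2], and 2 bounds the sum of the geometric series. *)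
exists (B * 2 / (r / 2) ^+ n) => v v0 vr.
have vr' : v < r by apply: le_lt_trans vr _; lra.
have S : series (fun j => c j * v ^+ j) N @[N --> \oo] --> g v by exact: cg.
have D : `|series (fun j => c j * v ^+ j) N - \sum_(0 <= j < n) c j * v ^+ j|
    @[N --> \oo] --> `|g v - \sum_(0 <= j < n) c j * v ^+ j|.
  by apply: cvg_norm; apply: cvgB => //; exact: cvg_cst.
apply: (cvgr_to_le D); exists n => // N /= nN.
rewrite /series /= (big_cat_nat (leq0n n) nN) /= addrAC subrr add0r.
pose q := v / (r / 2).
have q0 : 0 < q by rewrite divr_gt0.
have q2 : q <= 2^-1 by rewrite ler_pdivrMr //; lra.
have cE j : `|c j * v ^+ j| <= B * q ^+ j.
  rewrite /q expr_div_n mulrA ler_pdivlMr ?exprn_gt0 //.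
  rewrite normrM (ger0_norm (exprn_ge0 _ (ltW v0))) mulrAC.
  rewrite ler_wpM2r ?(exprn_ge0 _ (ltW v0)) //.
  have : `|c j * (r / 2) ^+ j| <= B by exact: HB.
  rewrite normrM (ger0_norm (exprn_ge0 _ (ltW r20))); exact.
apply: le_trans (ler_norm_sum _ _ _) _.
have -> : B * 2 / (r / 2) ^+ n * v ^+ n = (B * 2) * q ^+ n.
  by rewrite /q [(v / _) ^+ n]expr_div_n mulrAC mulrA.
apply: (@le_trans _ _ (\sum_(n <= j < N) B * q ^+ j)).
  by apply: ler_sum => j _; exact: cE.
rewrite -mulr_sumr -mulrA ler_wpM2l //.
rewrite -(subnKC nN) geometric_partial_tail.
apply: le_trans (geometric_le_lim _ _ q0 _) _.
- by rewrite exprn_ge0 // ltW.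
- by rewrite ger0_norm ?ltW //; lra.
rewrite mulrC ler_wpM2r ?(exprn_ge0 _ (ltW q0)) //.
rewrite -[2 in leRHS]invrK lef_pV2 ?posrE //; lra.
Qed.

Lemma ge0_integrable_EFin d (T : measurableType d) (R : realType)
    (mu : {measure set T -> \bar R}) (g : T -> R) (l : R) :
  measurable_fun setT g -> (forall x, 0 <= g x) ->
  (\int[mu]_x (g x)%:E = l%:E)%E -> mu.-integrable setT (EFin \o g).
Proof.
move=> mg g0 gl; apply/integrableP; split; first exact: measurableT_comp.
rewrite (_ : (\int[mu]_x `|(EFin \o g) x| = l%:E)%E) ?ltry // -gl.
by apply: eq_integral => x _; rewrite gee0_abs ?lee_fin.
Qed.

Lemma cvg_dist_le (R : realType) (u w : nat -> R) (l K : R) :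
  w @ \oo --> 0 -> (forall i, `|l - u i| <= K * w i) -> u @ \oo --> l.
Proof.
move=> w0 uw.
have Kw0 : K * w i @[i --> \oo] --> 0.
  by rewrite -[0](mulr0 K); apply: cvgM => //; exact: cvg_cst.
apply: (@squeeze_cvgr _ _ _ _ (fun i => l - K * w i) (fun i => l + K * w i)).
- by apply: nearW => i; rewrite -ler_distl distrC.
- by rewrite -[l in X in _ --> X](subr0 l); apply: cvgB => //; exact: cvg_cst.
- by rewrite -[l in X in _ --> X](addr0 l); apply: cvgD => //; exact: cvg_cst.
Qed.

(** Induction on [n]. Divided by [v ^+ n], the remainder of order [n] of the kernel stays below
    [m n x] and tends to it as [v] tends to 0, while its integral tends to [c n]. Fatou's lemma
    gives one inequality and the domination by [m n] the other. Now that [m n] is known to be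
    integrable, subtracting its term yields the integral of the next remainder. *)
Lemma integral_alternating_coef d (T : measurableType d) (R : realType)
    (mu : {measure set T -> \bar R}) (k : R -> T -> R) (m : nat -> T -> R)
    (J : R -> R) (c : nat -> R) (r : R) :
  0 < r ->
  (forall v, measurable_fun setT (k v)) ->
  (forall j, measurable_fun setT (m j)) -> (forall j x, 0 <= m j x) ->
  (forall n v x, 0 < v -> v < r ->
     0 <= altrem (fun j => m j x * v ^+ j) (k v x) n) ->
  (forall v, 0 < v -> v < r -> (\int[mu]_x (k v x)%:E = (J v)%:E)%E) ->
  (forall v, 0 < v -> v < r ->
     series (fun j => (-1) ^+ j * c j * v ^+ j) @ \oo --> J v) ->
  forall n, (\int[mu]_x (m n x)%:E = (c n)%:E)%E.
Proof.
move=> r0 mk mm m0 e0 kJ cJ.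
pose e n v x := altrem (fun j => m j x * v ^+ j) (k v x) n.
pose I n v := altrem (fun j => c j * v ^+ j) (J v) n.
have eS n v x : e n.+1 v x = m n x * v ^+ n - e n v x by exact: altremS.
have IS n v : I n.+1 v = c n * v ^+ n - I n v by exact: altremS.
have me n v : measurable_fun setT (e n v).
  elim: n => [|n IHn].
    by apply: eq_measurable_fun (mk v) => x _; rewrite /e altrem0.
  apply: (eq_measurable_fun (fun x => m n x * v ^+ n - e n v x)).
    by move=> x _; rewrite eS.
  by apply: measurable_funB => //; apply: measurable_funM => //.
have r40 : 0 < r / 4 by rewrite divr_gt0.
have r4r : r / 4 < r by lra.
(* A sequence tending to 0, since Fatou's lemma concerns sequences; it stays below [r / 4], where
   [cvg_series_remainder] applies. *)
pose w (i : nat) := r / 4 * harmonic i.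
have w0 i : 0 < w i by rewrite mulr_gt0 ?harmonic_gt0.
have wr4 i : w i <= r / 4.
  by apply: ler_piMr; [exact: ltW|rewrite /harmonic /= invf_le1 ?ler1n].
have wr i : w i < r := le_lt_trans (wr4 i) r4r.
have cw : w @ \oo --> 0.
  by rewrite -[0](mulr0 (r / 4)); apply: cvgM; [exact: cvg_cst|exact: cvg_harmonic].
have key n : (forall v, 0 < v -> v < r -> (\int[mu]_x (e n v x)%:E = (I n v)%:E)%E) ->
    (\int[mu]_x (m n x)%:E = (c n)%:E)%E.
  move=> eI.
  have cI : (fun i => I n (w i) / w i ^+ n) @ \oo --> c n.
    have [K HK] := cvg_series_remainder r0 cJ n.+1.
    apply: (cvg_dist_le (w := w) (K := K)) => // i.
    have wn0 : 0 < w i ^+ n by rewrite exprn_gt0.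
    rewrite -(@ler_pM2r _ (w i ^+ n)) //.
    rewrite -[X in _ * X <= _](gtr0_norm wn0) -normrM mulrBl.
    rewrite divfK ?gt_eqF // -IS -mulrA -exprS.
    apply: le_trans (HK _ (w0 i) (wr4 i)).
    rewrite /I /altrem normrM normrX normrN1 expr1n mul1r le_eqVlt.
    by under eq_bigr do rewrite mulrA; rewrite eqxx.
  pose g i x := e n (w i) x / w i ^+ n.
  have g0 i x : 0 <= g i x.
    by apply: divr_ge0; [exact: e0|apply: exprn_ge0; exact: ltW].
  have mg i : measurable_fun setT (g i) by apply: measurable_funM.
  have gI i : (\int[mu]_x (g i x)%:E = (I n (w i) / w i ^+ n)%:E)%E.
    under eq_integral do rewrite EFinM.
    rewrite ge0_integralZr //; last 3 first.
    - exact: measurableT_comp.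
    - by move=> x _; rewrite lee_fin; exact: e0.
    - by rewrite lee_fin invr_ge0 exprn_ge0 // ltW.
    by rewrite eI.
  have gm i x : g i x <= m n x.
    rewrite ler_pdivrMr ?exprn_gt0 // -subr_ge0 -eS.
    exact: e0.
  (* The gap is the remainder of order [n.+1] over [w i ^+ n]; it is at most [m n.+1 x * w i]
     because the remainder of order [n.+2] is nonnegative. *)
  have cg x : (fun i => g i x) @ \oo --> m n x.
    apply: (cvg_dist_le (w := w) (K := m n.+1 x)) => // i.
    rewrite ger0_norm ?subr_ge0 //.
    have wn0 : 0 < w i ^+ n by rewrite exprn_gt0.
    rewrite -(@ler_pM2r _ (w i ^+ n)) // mulrBl divfK ?gt_eqF // -eS.
    rewrite -mulrA -exprS -subr_ge0 -eS.
    exact: e0.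
  have mn_le : (\int[mu]_x (m n x)%:E <= (c n)%:E)%E.
    have := fatou mu measurableT (f := fun i x => (g i x)%:E).
    move=> /(_ (fun i => (measurable_EFinP _ _).2 (mg i))).
    move=> /(_ (fun i x _ => g0 i x)).
    rewrite (_ : limn_einf _ = (c n)%:E); last first.
      apply: (cvg_limn_einf_sup _).1.
      under eq_fun do rewrite gI.
      by apply: cvg_EFin; [exact: nearW|exact: cI].
    rewrite (eq_integral (fun x => (m n x)%:E)) // => x _.
    apply: (cvg_limn_einf_sup _).1.
    by apply: cvg_EFin; [exact: nearW|exact: cg].
  have mn0 : (0 <= \int[mu]_x (m n x)%:E)%E.
    by apply: integral_ge0 => x _; rewrite lee_fin.
  have mnfin : (\int[mu]_x (m n x)%:E)%E \is a fin_num.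
    by rewrite ge0_fin_numE // (le_lt_trans mn_le) ?ltry.
  apply/eqP; rewrite eq_le mn_le /= -(fineK mnfin) lee_fin.
  apply: (cvgr_to_le cI); apply: nearW => i.
  rewrite -lee_fin (fineK mnfin) -gI.
  apply: ge0_le_integral => //; do ?[exact: measurableT_comp];
    by move=> x _; rewrite lee_fin.
suff eI n v : 0 < v -> v < r -> (\int[mu]_x (e n v x)%:E = (I n v)%:E)%E.
  by move=> n; apply: key => v; exact: eI.
move=> v0 vr; elim: n v v0 vr => [|n IHn] v v0 vr.
  by rewrite /I altrem0 -kJ //; apply: eq_integral => x _; rewrite /e altrem0.
have mc := key n IHn.
have mvc : (\int[mu]_x (m n x * v ^+ n)%:E = (c n * v ^+ n)%:E)%E.
  under eq_integral do rewrite EFinM.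
  rewrite ge0_integralZr //; last 3 first.
  - exact: measurableT_comp.
  - by move=> x _; rewrite lee_fin.
  - by rewrite lee_fin exprn_ge0 // ltW.
  by rewrite mc.
under eq_integral do rewrite eS EFinB.
rewrite integralB_EFin //; last 2 first.
- apply: ge0_integrable_EFin mvc; first exact: measurable_funM.
  by move=> x; rewrite mulr_ge0 // exprn_ge0 // ltW.
- by apply: ge0_integrable_EFin (IHn v v0 vr) => // x; exact: e0.
by rewrite mvc IHn // IS EFinB.
Qed.

(** All terms are nonnegative, so the sum and the integral may be exchanged; convergence of the
    numerical series then makes the integral of the sum finite. *)
Lemma integral_power_series d (T : measurableType d) (R : realType)
    (mu : {measure set T -> \bar R}) (m : nat -> T -> R) (c : nat -> R)
    (h : T -> R) (l w : R) :
  0 <= w ->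
  (forall j, measurable_fun setT (m j)) -> (forall j x, 0 <= m j x) ->
  (forall n, (\int[mu]_x (m n x)%:E = (c n)%:E)%E) ->
  (forall x, series (fun j => m j x * w ^+ j) @ \oo --> h x) ->
  series (fun j => c j * w ^+ j) @ \oo --> l ->
  (\int[mu]_x (h x)%:E = l%:E)%E.
Proof.
move=> w0 mm m0 mc ch cl.
have sumE (u : nat -> R) s : series u @ \oo --> s ->
    (\sum_(n <oo) (u n)%:E = s%:E)%E.
  move=> us; apply/cvg_lim => //.
  under eq_fun do rewrite sumEFin.
  by apply: cvg_EFin; [exact: nearW|exact: us].
under eq_integral do rewrite -(sumE _ _ (ch _)).
rewrite integral_nneseries //; last 2 first.
- by move=> n; apply/measurable_EFinP; exact: measurable_funM.
- by move=> n x _; rewrite lee_fin mulr_ge0 // exprn_ge0.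
rewrite -(sumE _ _ cl); apply: eq_eseriesr => n _.
under eq_integral do rewrite EFinM.
rewrite ge0_integralZr //; last 3 first.
- exact: measurableT_comp.
- by move=> x _; rewrite lee_fin.
- by rewrite lee_fin exprn_ge0.
by rewrite mc.
Qed.

(** * The hyperbolic cosine, its derivatives and its Taylor series *)

(* The [p]-th derivative of [cosh (w * x)] with respect to [w]. *)
Definition coshD {R : realType} (p : nat) (w x : R) : R :=
  (x ^+ p * expR (w * x) + (- x) ^+ p * expR (- (w * x))) / 2.

(** The expression is even in [x]; for [x >= 0] the factor [x ^+ p] comes out and leaves
    [expR (w * x)] plus or minus the smaller [expR (- (w * x))]. *)
Lemma coshD_ge0 (R : realType) p (w x : R) : 0 <= w -> 0 <= coshD p w x.
Proof.
move=> w0; wlog x0 : x / 0 <= x => [H|].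
  have [/H//|/ltW x0] := leP 0 x.
  by have := H (- x); rewrite oppr_ge0 x0 /coshD !mulrN !opprK addrC; exact.
rewrite divr_ge0 // exprNn -[_ * x ^+ p]mulrC -mulrA -mulrDr.
rewrite mulr_ge0 ?exprn_ge0 //.
have h1 : expR (- (w * x)) <= expR (w * x).
  by rewrite ler_expR; have := mulr_ge0 w0 x0; lra.
have h2 := expR_ge0 (- (w * x)).
rewrite -signr_odd; case: (odd p); rewrite ?expr1 ?expr0; lra.
Qed.

Lemma is_derive_coshD (R : realType) p (w x : R) :
  is_derive w 1 ((@coshD R p)^~ x) (coshD p.+1 w x).
Proof.
pose l : R -> R := x \*: @id R.
have -> : (@coshD R p)^~ x =
    2^-1 \*: (x ^+ p \*: (expR \o l) + (- x) ^+ p \*: (expR \o - l)).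
  apply/funext => u; rewrite /coshD /l /GRing.scale /= !fctE /GRing.scale /=.
  by rewrite [u * x]mulrC [LHS]mulrC.
have dl : is_derive w 1 l (x *: 1) by exact: is_deriveZ.
have dp := is_derive1_comp (is_derive_expR (l w)) dl.
have dn := is_derive1_comp (is_derive_expR ((- l) w)) (is_deriveN dl).
have := is_deriveZ 2^-1 (is_deriveD (is_deriveZ (x ^+ p) dp) (is_deriveZ ((- x) ^+ p) dn)).
move/is_derive_eq; apply.
rewrite /coshD /l /GRing.scale /= !fctE /GRing.scale /= !exprS [w * x]mulrC.
by ring.
Qed.

Lemma continuous_coshD (R : realType) p (x : R) :
  continuous ((@coshD R p)^~ x).
Proof.
move=> w; apply/differentiable_continuous/derivable1_diffP.
by have [] := is_derive_coshD p w x.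
Qed.

(** Read backwards from [b], the hyperbolic cosine is completely monotone: each derivative in [v]
    changes the sign and raises the index of [coshD], which is nonnegative as long as
    [b - v >= 0]. *)
Lemma altrem_coshD_ge0 (R : realType) (b x : R) n v : 0 <= v -> v <= b ->
  0 <= altrem (fun j => coshD j b x / j`!%:R * v ^+ j) (coshD 0 (b - v) x) n.
Proof.
move=> v0 vb.
have := @completely_monotone_altrem_ge0 R (fun p v => coshD p (b - v) x) b.
rewrite subr0 => /(_ _ _ n v v0 vb).
rewrite (_ : (fun j => _ * v ^+ j / _) = fun j => coshD j b x / j`!%:R * v ^+ j).
  apply=> [p u|p u u0 ub]; last by rewrite coshD_ge0 // subr_ge0.
  have dl : is_derive u 1 (cst b - @id R) (0 - 1) by exact: is_deriveB.
  have := is_derive1_comp (is_derive_coshD p ((cst b - @id R) u) x) dl.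
  by rewrite sub0r mulrN1.
by apply/funext => j; rewrite mulrAC.
Qed.

Lemma cvg_series_expR (R : realType) (x : R) :
  series (fun j => x ^+ j / j`!%:R) @ \oo --> expR x.
Proof. exact: is_cvg_series_exp_coeff. Qed.

Lemma cvg_series_coshD (R : realType) (b w x : R) :
  series (fun j => coshD j b x / j`!%:R * w ^+ j) @ \oo --> coshD 0 (b + w) x.
Proof.
pose S y := series (fun j => y ^+ j / j`!%:R : R).
have -> : series (fun j => coshD j b x / j`!%:R * w ^+ j) =
    (fun n => (expR (b * x) * S (w * x) n + expR (- (b * x)) * S (- (w * x)) n) / 2).
  apply/funext => n; rewrite /S /series /= !mulr_sumr -big_split /= mulr_suml.
  apply: eq_bigr => j _; rewrite /coshD -(mulrN w) !exprMn.
  by field; rewrite pnatr_eq0 -lt0n fact_gt0.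
have -> : coshD 0 (b + w) x =
    (expR (b * x) * expR (w * x) + expR (- (b * x)) * expR (- (w * x))) / 2.
  by rewrite /coshD !expr0 !mul1r (mulrDl b) opprD !expRD.
apply: cvgMr_tmp; apply: cvgD; apply: cvgMl_tmp; exact: cvg_series_expR.
Qed.

Lemma measurable_coshD (R : realType) p (w : R) :
  measurable_fun setT (@coshD R p w).
Proof.
have mw : measurable_fun [set: R] (fun x => w * x) by exact: measurable_funM.
have mN : measurable_fun [set: R] (fun x => - x : R) by exact: measurableT_comp.
apply: measurable_funM => //; apply: measurable_funD; apply: measurable_funM.
- exact: measurable_funX.
- exact: measurableT_comp.
- exact: measurable_funX.
- apply: measurableT_comp => //; exact: measurableT_comp.
Qed.

(** * Taylor remainders of the cosine *)

Lemma is_derive_exprn_fact (R : realType) n (y : R) :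
  is_derive y 1 (fun z => z ^+ n.+1 / n.+1`!%:R) (y ^+ n / n`!%:R).
Proof.
have -> : (fun z : R => z ^+ n.+1 / n.+1`!%:R) = n.+1`!%:R^-1 \*: (@id R ^+ n.+1).
  by apply/funext => z; rewrite exprfctE /GRing.scale /= mulrC.
apply: is_derive_eq; rewrite /GRing.scale /= factS natrM mulr1.
have h1 : n.+1%:R != 0 :> R by rewrite pnatr_eq0.
have h2 : n`!%:R != 0 :> R by rewrite pnatr_eq0 -lt0n fact_gt0.
by move: (n.+1%:R : R) (n`!%:R : R) h1 h2 => a d a0 d0; field; rewrite a0 d0.
Qed.

(** Joint induction with the sine: its remainder [S k] has derivative [C k], the cosine remainder
    [C k.+1] has derivative [S k], and all of these vanish at 0. The induction starts from
    [1 - cos y >= 0]; order 0 is excluded because the cosine itself changes sign. *)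
Lemma altrem_cos_ge0 (R : realType) n (y : R) : 0 <= y ->
  0 <= altrem (fun j => y ^+ j.*2 / j.*2`!%:R) (cos y) n.+1.
Proof.
pose C n (y : R) := altrem (fun j => y ^+ j.*2 / j.*2`!%:R) (cos y) n.
pose S n (y : R) := altrem (fun j => y ^+ j.*2.+1 / j.*2.+1`!%:R) (sin y) n.
have CS k z : C k.+1 z = z ^+ k.*2 / k.*2`!%:R - C k z by exact: altremS.
have SS k z : S k.+1 z = z ^+ k.*2.+1 / k.*2.+1`!%:R - S k z by exact: altremS.
have C0 z : C 0%N z = cos z by exact: altrem0.
have S0 z : S 0%N z = sin z by exact: altrem0.
have dS k (z : R) : is_derive z 1 (S k) (C k z).
  elim: k => [|k IHk].
    rewrite C0 (_ : S 0%N = sin); first exact: is_derive_sin.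
    by apply/funext => u; exact: S0.
  rewrite CS (_ : S k.+1 = (fun u => u ^+ k.*2.+1 / k.*2.+1`!%:R) - S k).
    exact: is_deriveB (is_derive_exprn_fact _ _) IHk.
  by apply/funext => u; exact: SS.
have dC k (z : R) : is_derive z 1 (C k.+1) (S k z).
  elim: k => [|k IHk].
    rewrite (_ : C 1%N = cst 1 - cos); last first.
      by apply/funext => u; rewrite CS C0 expr0 fact0 divr1.
    by rewrite S0 -[sin z]opprK -[- - sin z]sub0r; exact: is_deriveB.
  rewrite SS (_ : C k.+2 = (fun u => u ^+ k.*2.+2 / k.*2.+2`!%:R) - C k.+1).
    exact: is_deriveB (is_derive_exprn_fact _ _) IHk.
  by apply/funext => u; rewrite CS doubleS.
have C00 k : C k.+1 0 = 0.
  elim: k => [|k IHk]; first by rewrite CS C0 cos0 expr0 fact0 divr1 subrr.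
  by rewrite CS IHk subr0 doubleS expr0n /= mul0r.
have S00 k : S k 0 = 0.
  elim: k => [|k IHk]; first by rewrite S0 sin0.
  by rewrite SS IHk subr0 expr0n /= mul0r.
move=> y0; rewrite -/(C n.+1 y).
suff : 0 <= C n.+1 y /\ 0 <= S n.+1 y by case.
elim: n y y0 => [|n IHn] y y0.
  have C1 z : 0 <= C 1%N z.
    by rewrite CS C0 expr0 fact0 divr1 subr_ge0 cos_le1.
  by split=> //; apply: (ge0_of_derive_ge0 (dS 1%N) _ (S00 _) y0 (lexx y)) => z _ _.
have Cn z : 0 <= z -> 0 <= C n.+2 z.
  move=> z0; apply: (ge0_of_derive_ge0 (dC n.+1) _ (C00 _) z0 (lexx z)) => u u0 _.
  exact: (IHn u u0).2.
split; first exact: Cn.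
by apply: (ge0_of_derive_ge0 (dS n.+2) _ (S00 _) y0 (lexx y)) => z z0 _; exact: Cn.
Qed.

(** * From expectations of the cosine to expectations of the hyperbolic cosine *)

Lemma cvg_series_add_head (R : realType) (a : nat -> R) (l : R) :
  series a @ \oo --> l ->
  series (fun j => a j + (j == 0%N)%:R) @ \oo --> l + 1.
Proof.
move=> al.
have -> : series (fun j => a j + (j == 0%N)%:R) =
    (fun n => series a n + series (fun j => (j == 0%N)%:R) n).
  by apply/funext => n; rewrite /series /= big_split.
(* The empty partial sum is 0, so the partial sums are constantly 1 only from index 1 on. *)
apply: cvgD => //; rewrite -cvg_shiftS.
rewrite (_ : (fun n => _) = cst 1); first exact: cvg_cst.
apply/funext => n; rewrite /series /= big_nat_recl //= big1 ?addr0 //.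
Qed.

(** Subtracting the first term already cancels the added 1, so replacing the cosine by [1 + cos]
    alters only the remainder of order 0. *)
Lemma altrem_add_head (R : realType) (a : nat -> R) (l : R) n :
  altrem (fun j => a j + (j == 0%N)%:R) (1 + l) n.+1 = altrem a l n.+1.
Proof.
elim: n => [|n IHn]; first by rewrite !altremS !altrem0 /=; ring.
by rewrite altremS IHn addr0 -altremS.
Qed.

Lemma cvg_series_even (R : realType) (u : nat -> R) (l : R) :
  (forall j, u j.*2.+1 = 0) -> series u @ \oo --> l ->
  series (fun j => u j.*2) @ \oo --> l.
Proof.
move=> u0 ul.
have -> : series (fun j => u j.*2) = series u \o double.
  apply/funext => n /=; rewrite /series /=; elim: n => [|n IHn].
    by rewrite !big_nil.
  by rewrite big_nat_recr //= IHn doubleS !big_nat_recr //= u0 addr0.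
apply: cvg_comp ul; apply/cvgnyPge => N.
by exists N => // n /= Nn; rewrite -addnn (leq_trans Nn) ?leq_addr.
Qed.

(** The odd derivatives of the hyperbolic cosine vanish at 0, and the square root turns the
    remaining even powers into all powers of [w]. *)
Lemma cvg_series_cosh_sqrt (R : realType) (w x : R) : 0 <= w ->
  series (fun j => x ^+ j.*2 / j.*2`!%:R * w ^+ j) @ \oo -->
    coshD 0 (Num.sqrt w) x.
Proof.
move=> w0; have := @cvg_series_coshD R 0 (Num.sqrt w) x; rewrite add0r.
move=> /(@cvg_series_even R) H.
have D0 j : coshD j 0 x = (x ^+ j + (- x) ^+ j) / 2.
  by rewrite /coshD mul0r oppr0 expR0 !mulr1.
have /H : forall j, coshD j.*2.+1 0 x / j.*2.+1`!%:R * Num.sqrt w ^+ j.*2.+1 = 0.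
  by move=> j; rewrite D0 exprNn -signr_odd /= odd_double expr1 mulN1r subrr !mul0r.
apply: cvg_trans; rewrite (_ : (fun j => _) =
  (fun j => coshD j.*2 0 x / j.*2`!%:R * Num.sqrt w ^+ j.*2)) //.
apply/funext => j; rewrite D0 exprNn -signr_odd odd_double expr0 mul1r.
have -> : w ^+ j = Num.sqrt w ^+ j.*2 by rewrite -mul2n exprM sqr_sqrtr.
by field; rewrite pnatr_eq0 -lt0n fact_gt0.
Qed.

Lemma measurable_cos (R : realType) : measurable_fun [set: R] (@cos R).
Proof. by apply: continuous_measurable_fun; exact: continuous_cos. Qed.

Lemma measurable_sin (R : realType) : measurable_fun [set: R] (@sin R).
Proof. by apply: continuous_measurable_fun; exact: continuous_sin. Qed.

Lemma integrable_norm_le1 d (T : measurableType d) (R : realType)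
    (mu : probability T R) (g : T -> R) :
  measurable_fun setT g -> (forall x, `|g x| <= 1) ->
  mu.-integrable setT (EFin \o g).
Proof.
move=> mg g1; apply: (@le_integrable _ _ _ mu _ measurableT _ (EFin \o cst 1)).
- exact/measurable_EFinP.
- by move=> x _; rewrite lee_fin normr1.
- exact: finite_measure_integrable_cst.
Qed.

(* The kernel is [1 + cos] rather than [cos] because the remainder of order 0
   has to be nonnegative as well. *)
Lemma integral_cosh_of_cos d (T : measurableType d) (R : realType)
    (mu : probability T R) (X : T -> R) (J : R -> R) (c : nat -> R) (r l w : R) :
  measurable_fun setT X -> 0 < r ->
  (forall v, 0 < v -> v < r -> \int[mu]_x cos (Num.sqrt v * X x) = J v) ->
  (forall v, 0 < v -> v < r ->
     series (fun j => (-1) ^+ j * c j * v ^+ j) @ \oo --> J v) ->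
  0 <= w -> series (fun j => c j * w ^+ j) @ \oo --> l ->
  (\int[mu]_x (coshD 0 (Num.sqrt w) (X x))%:E = l%:E)%E.
Proof.
move=> mX r0 Jcos cJ w0 cl.
pose m j x := X x ^+ j.*2 / j.*2`!%:R + (j == 0%N)%:R.
have mvX v : measurable_fun setT (fun x => Num.sqrt v * X x).
  exact: measurable_funM.
have mcos v : measurable_fun setT (fun x => cos (Num.sqrt v * X x)).
  by apply: measurableT_comp => //; exact: measurable_cos.
have icos v : mu.-integrable setT (EFin \o (fun x => cos (Num.sqrt v * X x))).
  by apply: integrable_norm_le1 => // x; rewrite ler_norml cos_geN1 cos_le1.
have mm j : measurable_fun setT (m j).
  apply: measurable_funD => //; apply: measurable_funM => //.
  exact: measurable_funX.
have m0 j x : 0 <= m j x.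
  by rewrite addr_ge0 // divr_ge0 // -mul2n exprM exprn_ge0 // sqr_ge0.
have int1 : (\int[mu]_x (cst 1 x)%:E = 1)%E.
  by rewrite (eq_integral (cst 1%E)) // integral_cst // mul1e; exact: probability_setT.
have kJ v : 0 < v -> v < r ->
    (\int[mu]_x (1 + cos (Num.sqrt v * X x))%:E = (J v + 1)%:E)%E.
  move=> v0 vr; under eq_integral do rewrite EFinD.
  have i1 : mu.-integrable setT (EFin \o cst 1).
    exact: finite_measure_integrable_cst.
  rewrite (integralD_EFin measurableT i1 (icos v)) int1 addeC EFinD -Jcos // /Rintegral fineK //.
  by apply: integrable_fin_num => //; exact: icos.
have ck v : 0 < v -> v < r ->
    series (fun j => (-1) ^+ j * (c j + (j == 0%N)%:R) * v ^+ j) @ \oo --> J v + 1.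
  move=> v0 vr; have := cvg_series_add_head (cJ v v0 vr).
  apply: cvg_trans; rewrite (_ : (fun j => _) =
    fun j => (-1) ^+ j * c j * v ^+ j + (j == 0%N)%:R) //.
  apply/funext => -[|j] /=; last by rewrite !addr0.
  by rewrite !expr0 !mulr1 !mul1r.
have e0 n v x : 0 < v -> v < r ->
    0 <= altrem (fun j => m j x * v ^+ j) (1 + cos (Num.sqrt v * X x)) n.
  move=> v0 vr; case: n => [|n].
    by rewrite altrem0; have := cos_geN1 (Num.sqrt v * X x); lra.
  (* The bound on cosine remainders requires a nonnegative argument. *)
  have -> : cos (Num.sqrt v * X x) = cos (Num.sqrt v * `|X x|).
    have [x0|x0] := leP 0 (X x); first by rewrite ger0_norm.
    by rewrite ltr0_norm // mulrN cosN.
  rewrite (_ : (fun j => _) = fun j =>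
      (Num.sqrt v * `|X x|) ^+ j.*2 / j.*2`!%:R + (j == 0%N)%:R).
    by rewrite altrem_add_head; apply: altrem_cos_ge0; rewrite mulr_ge0 ?sqrtr_ge0.
  apply/funext => j; rewrite /m mulrDl; congr (_ + _); last first.
    by case: j => [|j]; rewrite ?expr0 ?mulr1 ?mul0r.
  rewrite exprMn -mul2n !exprM sqr_sqrtr ?(ltW v0) // real_normK ?num_real //.
  by rewrite mulrAC [v ^+ j * _]mulrC.
(* Up to the extra 1 at index 0, [c n] is identified as the moment of order [2n] of [X] divided by
   [(2n)!]. *)
have mc n : (\int[mu]_x (m n x)%:E = (c n + (n == 0%N)%:R)%:E)%E.
  apply: (integral_alternating_coef r0 _ mm m0 e0 kJ ck) => v.
  exact: measurable_funD.
have cc : series (fun j => (c j + (j == 0%N)%:R) * w ^+ j) @ \oo --> l + 1.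
  have := cvg_series_add_head cl.
  apply: cvg_trans; rewrite (_ : (fun j => _) = fun j => c j * w ^+ j + (j == 0%N)%:R) //.
  apply/funext => -[|j] /=; last by rewrite !addr0.
  by rewrite !expr0 !mulr1.
have mcosh x : series (fun j => m j x * w ^+ j) @ \oo -->
    coshD 0 (Num.sqrt w) (X x) + 1.
  have := cvg_series_add_head (@cvg_series_cosh_sqrt R w (X x) w0).
  apply: cvg_trans; rewrite (_ : (fun j => _) =
    fun j => X x ^+ j.*2 / j.*2`!%:R * w ^+ j + (j == 0%N)%:R) //.
  apply/funext => -[|j] /=; rewrite /m /= ?addr0 //.
  by rewrite !expr0 !mulr1.
(* Without the alternating signs the same coefficients sum to the hyperbolic cosine; the auxiliary 1
   is then cancelled. *)
have := integral_power_series w0 mm m0 mc mcosh cc.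
under eq_integral do rewrite EFinD.
rewrite ge0_integralD //; last 2 first.
- by move=> x _; rewrite lee_fin coshD_ge0 ?sqrtr_ge0.
- apply: measurableT_comp => //; apply: measurableT_comp => //; exact: measurable_coshD.
rewrite int1 => H.
by rewrite -[LHS](@addeK _ 1%E) // H EFinD addeK.
Qed.

(** * Real and imaginary parts of complex power series *)

(** Lets one expansion serve twice: for the real part, which equals an expectation, and for the
    imaginary part, which has to vanish. *)
Definition coordinate {R : realType} (P : R[i] -> R) :=
  P = @complex.Re R \/ P = @complex.Im R.

Lemma coordinate_Re (R : realType) : coordinate (@complex.Re R).
Proof. by left. Qed.

Lemma coordinate_Im (R : realType) : coordinate (@complex.Im R).
Proof. by right. Qed.

Lemma coordinateD (R : realType) (P : R[i] -> R) : coordinate P ->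
  {morph P : x y / x + y}.
Proof. by case=> -> [a b] [c e]. Qed.

Lemma coordinateB (R : realType) (P : R[i] -> R) : coordinate P ->
  {morph P : x y / x - y}.
Proof. by case=> -> [a b] [c e]. Qed.

Lemma coordinate_realM (R : realType) (P : R[i] -> R) : coordinate P ->
  forall z x, P (z * x%:C) = P z * x.
Proof.
by case=> -> [a b] x; rewrite /= mulr0 ?subr0 ?add0r.
Qed.

Lemma coordinate_signM (R : realType) (P : R[i] -> R) : coordinate P ->
  forall n z, P ((-1) ^+ n * z) = (-1) ^+ n * P z.
Proof.
move=> cP n z; rewrite -[in LHS]signr_odd -[in RHS]signr_odd.
case: (odd n); rewrite ?expr0 ?expr1 ?mul1r // !mulN1r.
by case: cP z => -> [].
Qed.

Lemma coordinate_norm_le (R : realType) (P : R[i] -> R) : coordinate P ->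
  forall z, `|P z| <= Normc.normc z.
Proof.
case=> -> [a b] /=; rewrite -sqrtr_sqr ler_wsqrtr // ?lerDl ?lerDr sqr_ge0 //.
Qed.

Lemma cvg_coordinate (R : realType) (P : R[i] -> R) (u : nat -> (R[i])^o)
    (l : (R[i])^o) :
  coordinate P -> u @ \oo --> l -> (P \o u) @ \oo --> P l.
Proof.
move=> cP ul; apply/cvgrPdist_lt => e e0.
have e0' : 0 < e%:C :> R[i] by rewrite ltcR.
have H0 := (cvgrPdist_lt (V := (R[i])^o) _ _).1 ul _ e0'.
case: H0 => N _ HN; exists N => // n /HN /=; rewrite ltcR => H.
rewrite /= -(coordinateB cP); exact: le_lt_trans (coordinate_norm_le cP _) H.
Qed.

Lemma cvg_series_coordinate (R : realType) (P : R[i] -> R) (u : nat -> R[i])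
    (l : R[i]) :
  coordinate P -> series (fun n => u n : (R[i])^o) @ \oo --> (l : (R[i])^o) ->
  series (fun n => P (u n)) @ \oo --> P l.
Proof.
move=> cP ul.
have -> : series (fun n => P (u n)) = P \o series (fun n => u n : (R[i])^o).
  apply/funext => n; rewrite /series /=; elim: n => [|n IHn].
    by rewrite !big_nil; case: cP => ->.
  by rewrite !big_nat_recr //= coordinateD // IHn.
exact: cvg_coordinate.
Qed.

(** Averaging the two series kills the terms of odd index. *)
Lemma cvg_series_even_part (R : realType) (u : nat -> R) (l l' : R) :
  series u @ \oo --> l -> series (fun n => (-1) ^+ n * u n) @ \oo --> l' ->
  series (fun j => u j.*2) @ \oo --> (l + l') / 2.
Proof.
move=> ul ul'; pose t n := (u n + (-1) ^+ n * u n) / 2.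
have -> : (fun j => u j.*2) = (fun j => t j.*2).
  by apply/funext => j; rewrite /t -signr_odd odd_double expr0; field.
apply: cvg_series_even => [j|].
  by rewrite /t -signr_odd /= odd_double expr1 mulN1r subrr mul0r.
rewrite (_ : series t =
    (fun n => (series u n + series (fun n => (-1) ^+ n * u n) n) / 2)).
  by apply: cvgMr_tmp; exact: cvgD.
by apply/funext => n; rewrite /series /= -big_split /= mulr_suml.
Qed.

(* The case of the zero kernel in [integral_alternating_coef]. *)
Lemma alternating_series_coef0 (R : realType) (c : nat -> R) (r : R) : 0 < r ->
  (forall v, 0 < v -> v < r ->
     series (fun j => (-1) ^+ j * c j * v ^+ j) @ \oo --> 0) ->
  forall n, c n = 0.
Proof.
move=> r0 c0 n; apply: EFin_inj.
have int0 : (\int[@lebesgue_measure R]_x 0%:E = 0 :> \bar R)%E by exact: integral0.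
rewrite -[RHS]int0; apply/esym.
apply: (@integral_alternating_coef _ _ R lebesgue_measure (fun _ => cst 0)
  (fun _ => cst 0) (fun=> 0) c r) => // n' v x _ _.
suff -> : altrem (fun j => cst 0 x * v ^+ j) (cst 0 x) n' = 0 by [].
rewrite /altrem big1 ?subrr ?mulr0 // => j _.
by rewrite /= mul0r mulr0.
Qed.

(** * Expansions of the analytic function along the imaginary axis *)

Lemma expc_imag (R : realType) (v : R) n :
  (0 +i* v) ^+ n = (0 +i* 1) ^+ n * (v ^+ n)%:C.
Proof.
have -> : 0 +i* v = (0 +i* 1) * v%:C :> R[i].
  by rewrite -[RHS]/(_ +i* _) !mul0r mulr0 subrr mul1r add0r.
by rewrite exprMn rmorphXn.
Qed.

Lemma expc_imag_even (R : realType) (v : R) j :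
  (0 +i* v) ^+ j.*2 = ((-1) ^+ j * (v ^+ 2) ^+ j)%:C.
Proof.
rewrite -mul2n exprM.
have -> : (0 +i* v) ^+ 2 = (- (v ^+ 2))%:C :> R[i].
  by rewrite expr2 -[LHS]/(_ +i* _) !mul0r mulr0 addr0 sub0r expr2.
by rewrite -exprNn rmorphXn.
Qed.

Definition imag_mean {R : realType} (f : R[i] -> R[i]) (u : R) : R[i] :=
  (f (0 +i* u) + f (0 -i* u)) / 2.

Lemma coordinate_imag_mean (R : realType) (P : R[i] -> R) (f : R[i] -> R[i]) u :
  coordinate P -> P (imag_mean f u) = (P (f (0 +i* u)) + P (f (0 -i* u))) / 2.
Proof.
move=> cP; rewrite /imag_mean.
have -> : (2^-1 : R[i]) = (2^-1)%:C by rewrite fmorphV /= rmorph_nat.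
by rewrite coordinate_realM // coordinateD.
Qed.

(** The expansions at [ib] and [-ib] are evaluated at the increments [iv] and [-iv]. Absorbing the
    powers of [i] and the sign [(-1) ^+ n] of the second series into the coefficients leaves a
    single series in the real variable [v]. *)
Lemma analytic_imag_mean (R : realType) (rho : \bar R) (f : R[i] -> R[i]) (b : R) :
  analytic_on (cdisc 0 rho) f -> (`|b|%:E < rho)%E ->
  exists (c : nat -> R[i]) (r : R), 0 < r /\ forall P v, coordinate P -> `|v| < r ->
    series (fun n => P (c n) * v ^+ n) @ \oo --> P (imag_mean f (b + v)).
Proof.
move=> fA b_rho.
have inD (e : R) : `|e| = `|b| -> cdisc 0 rho (0 +i* e).
  by move=> eb; rewrite /cdisc /= !subr0 expr0n /= add0r sqrtr_sqr eb.
have [a1 [r1 [r10 H1]]] := fA _ (inD b erefl).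
have [a2 [r2 [r20 H2]]] := fA _ (inD (- b) (normrN b)).
exists (fun n => (a1 n * (0 +i* 1) ^+ n + (-1) ^+ n * (a2 n * (0 +i* 1) ^+ n)) / 2).
exists (Num.min r1 r2); split=> [|P v cP]; first by rewrite lt_min r10.
rewrite lt_min => /andP[vr1 vr2].
have S1 : series (fun n => P (a1 n * (0 +i* 1) ^+ n) * v ^+ n) @ \oo -->
    P (f (0 +i* (b + v))).
  have zE : 0 +i* (b + v) - 0 +i* b = 0 +i* v :> R[i].
    by rewrite -[LHS]/(_ +i* _) subrr addrAC subrr add0r.
  have /H1/(cvg_series_coordinate cP) : cdisc (0 +i* b) r1%:E (0 +i* (b + v)).
    by rewrite /cdisc /mkset zE /= expr0n /= add0r sqrtr_sqr lte_fin.
  apply: cvg_trans; rewrite (_ : (fun n => P (a1 n * (_ - _) ^+ n)) =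
    fun n => P (a1 n * (0 +i* 1) ^+ n) * v ^+ n) //.
  by apply/funext => n; rewrite zE expc_imag mulrA coordinate_realM.
have S2 : series (fun n => (-1) ^+ n * P (a2 n * (0 +i* 1) ^+ n) * v ^+ n) @ \oo -->
    P (f (0 -i* (b + v))).
  have zE : 0 -i* (b + v) - 0 -i* b = 0 +i* - v :> R[i].
    by rewrite -[LHS]/(_ +i* _) subrr opprD addrAC subrr add0r.
  have /H2/(cvg_series_coordinate cP) : cdisc (0 -i* b) r2%:E (0 -i* (b + v)).
    by rewrite /cdisc /mkset zE /= expr0n /= add0r sqrrN sqrtr_sqr lte_fin.
  apply: cvg_trans; rewrite (_ : (fun n => P (a2 n * (_ - _) ^+ n)) =
    fun n => (-1) ^+ n * P (a2 n * (0 +i* 1) ^+ n) * v ^+ n) //.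
  apply/funext => n; rewrite zE expc_imag mulrA coordinate_realM //.
  by rewrite [(- v) ^+ n]exprNn mulrCA mulrA.
rewrite coordinate_imag_mean //.
rewrite (_ : series (fun n => P (_ / 2) * _) = (fun n =>
    (series (fun n => P (a1 n * (0 +i* 1) ^+ n) * v ^+ n) n +
     series (fun n => (-1) ^+ n * P (a2 n * (0 +i* 1) ^+ n) * v ^+ n) n) / 2)).
  by apply: cvgMr_tmp; exact: cvgD.
have E2 : (2^-1 : R[i]) = (2^-1)%:C by rewrite fmorphV /= rmorph_nat.
apply/funext => n; rewrite /series /= -big_split /= mulr_suml.
apply: eq_bigr => j _; rewrite E2 coordinate_realM // coordinateD //.
by rewrite coordinate_signM //; field.
Qed.

(** The link between the two axes: the even coefficients of the expansion at 0 describe the even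
    part of [f] on the real axis and, with alternating signs, on the imaginary axis. The variable
    [v] is the square of the distance to 0, hence the radius [r ^+ 2]. *)
Lemma analytic_even_coordinates (R : realType) (rho : \bar R) (f : R[i] -> R[i]) :
  (0 < rho)%E -> analytic_on (cdisc 0 rho) f ->
  exists (a : nat -> R[i]) (r : R), 0 < r /\ forall P (v : R), coordinate P ->
    0 <= v -> v < r ->
    series (fun j => P (a j) * v ^+ j) @ \oo -->
      (P (f (Num.sqrt v)%:C) + P (f (- Num.sqrt v)%:C)) / 2 /\
    series (fun j => (-1) ^+ j * P (a j) * v ^+ j) @ \oo -->
      P (imag_mean f (Num.sqrt v)).
Proof.
move=> rho0 fA.
have D0 : cdisc 0 rho (0 : R[i]).
  by rewrite /cdisc /= !subr0 expr0n /= addr0 sqrtr0.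
have [a [r [r0 H]]] := fA _ D0.
exists (fun j => a j.*2), (r ^+ 2); split=> [|P v cP v0 vr].
  by rewrite exprn_gt0.
have svr : Num.sqrt v < r.
  by rewrite -(ger0_norm (ltW r0)) -sqrtr_sqr ltr_sqrt // exprn_gt0.
set t := Num.sqrt v; have tv : t ^+ 2 = v by rewrite sqr_sqrtr.
have tn : `|t| = t by rewrite ger0_norm ?sqrtr_ge0.
have Hs z : Normc.normc z < r ->
    series (fun n => P (a n * z ^+ n)) @ \oo --> P (f z).
  move=> zr; have /H/(cvg_series_coordinate cP) : cdisc 0 r%:E z.
    by rewrite /cdisc /= subr0 lte_fin.
  by under eq_fun do rewrite subr0.
have pm z : Normc.normc z < r ->
    series (fun j => P (a j.*2 * z ^+ j.*2)) @ \oo --> (P (f z) + P (f (- z))) / 2.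
  move=> zr; apply: cvg_series_even_part (Hs z zr) _.
  have : Normc.normc (- z) < r by case: z zr => x y; rewrite /= !sqrrN.
  move=> /Hs; rewrite (_ : (fun n => P (a n * (- z) ^+ n)) =
    (fun n => (-1) ^+ n * P (a n * z ^+ n))) //.
  by apply/funext => n; rewrite [(- z) ^+ n]exprNn mulrCA coordinate_signM.
split.
  have := pm t%:C; rewrite /= expr0n /= addr0 sqrtr_sqr tn => /(_ svr).
  rewrite (_ : (fun j => P (_ * t%:C ^+ j.*2)) = fun j => P (a j.*2) * v ^+ j).
    by rewrite -rmorphN.
  apply/funext => j.
  by rewrite -rmorphXn coordinate_realM // -mul2n exprM tv.
have := pm (0 +i* t); rewrite /= expr0n /= add0r sqrtr_sqr tn => /(_ svr).
rewrite (_ : (fun j => P (_ * (0 +i* t) ^+ j.*2)) =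
    fun j => (-1) ^+ j * P (a j.*2) * v ^+ j).
  by rewrite coordinate_imag_mean // -[- (0 +i* t)]/(_ +i* _) oppr0.
apply/funext => j; rewrite expc_imag_even coordinate_realM // tv.
by ring.
Qed.

(** * Propagation of the identity with the expectation of the hyperbolic cosine *)

(** The first equation lives in the extended reals, so it also asserts that the expectation is
    finite; the second records that the mean is real. *)
Definition cosh_transform_at d (T : measurableType d) (R : realType)
    (mu : probability T R) (X : T -> R) (f : R[i] -> R[i]) (u : R) :=
  (\int[mu]_x (coshD 0 u (X x))%:E = (complex.Re (imag_mean f u))%:E)%E /\
  complex.Im (imag_mean f u) = 0.

Lemma cvg_series_zero_coef (R : realType) (c : nat -> R) (l w : R) :
  (forall n, c n = 0) -> series (fun n => c n * w ^+ n) @ \oo --> l -> l = 0.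
Proof.
move=> c0; rewrite (_ : series _ = cst 0).
  by move=> l0; rewrite -(cvg_lim _ l0) // lim_cst.
by apply/funext => n; rewrite /series /= big1 // => i _; rewrite c0 mul0r.
Qed.

(** On the real axis the even part of [f] has real part the expectation of [cos (t X)] and imaginary
    part 0, the sine being odd. The former feeds [integral_cosh_of_cos]; the latter makes the
    imaginary parts of all even coefficients vanish. *)
Lemma cosh_transform_near0 d (T : measurableType d) (R : realType)
    (mu : probability T R) (X : T -> R) (rho : \bar R) (f : R[i] -> R[i]) (s : R) :
  measurable_fun setT X -> analytic_on (cdisc 0 rho) f ->
  0 < s -> (s%:E < rho)%E ->
  (forall t, `|t| < s -> complex.Re (f t%:C) = \int[mu]_x cos (t * X x)) ->
  (forall t, `|t| < s -> complex.Im (f t%:C) = \int[mu]_x sin (t * X x)) ->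
  exists e, 0 < e /\ forall u, 0 <= u -> u < e -> cosh_transform_at mu X f u.
Proof.
move=> mX fA s0 s_rho fRe fIm.
have rho0 : (0 < rho)%E by apply: lt_trans s_rho; rewrite lte_fin.
have [a [r [r0 H]]] := analytic_even_coordinates rho0 fA.
have s20 : 0 < s ^+ 2 by rewrite exprn_gt0.
(* For [v < q] the expansion converges and [Num.sqrt v < s], so [f] is given there by the cosine and
   sine integrals. *)
pose q := Num.min r (s ^+ 2).
have q0 : 0 < q by rewrite lt_min r0.
have qr v : v < q -> v < r by rewrite lt_min => /andP[].
have qs v : 0 <= v -> v < q -> `|Num.sqrt v| < s.
  move=> v0; rewrite lt_min => /andP[_ vs].
  by rewrite ger0_norm ?sqrtr_ge0 // -(ger0_norm (ltW s0)) -sqrtr_sqr ltr_sqrt.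
exists (Num.sqrt q); split=> [|u u0 uq]; first by rewrite sqrtr_gt0.
have u2 : Num.sqrt (u ^+ 2) = u by rewrite sqrtr_sqr ger0_norm.
have u2q : u ^+ 2 < q by rewrite -ltr_sqrt // u2.
have sgn P v j : (-1) ^+ j * ((-1) ^+ j * P (a j)) * v ^+ j = P (a j) * v ^+ j :> R.
  by rewrite mulrA -exprD addnn -signr_odd odd_double mul1r.
split.
- rewrite -[in LHS]u2.
  apply: (@integral_cosh_of_cos _ _ _ mu X (fun v => (complex.Re (f (Num.sqrt v)%:C) +
    complex.Re (f (- Num.sqrt v)%:C)) / 2)
    (fun j => (-1) ^+ j * complex.Re (a j)) q) => //.
  + move=> v v0 vq; rewrite !fRe ?normrN ?(qs v (ltW v0)) //.
    rewrite (_ : \int[mu]_x cos (- _ * _) = \int[mu]_x cos (Num.sqrt v * X x)).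
      by field.
    by apply: eq_Rintegral => x _; rewrite mulNr cosN.
  + move=> v v0 vq; have [+ _] := H _ v (coordinate_Re R) (ltW v0) (qr _ vq).
    by under [X in series X]eq_fun do rewrite -sgn.
  + exact: sqr_ge0.
  + have [_] := H _ _ (coordinate_Re R) (sqr_ge0 u) (qr _ u2q).
    by rewrite u2.
- have [_] := H _ _ (coordinate_Im R) (sqr_ge0 u) (qr _ u2q).
  rewrite u2; apply: cvg_series_zero_coef.
  apply: (alternating_series_coef0 q0) => v v0 vq.
  have [+ _] := H _ v (coordinate_Im R) (ltW v0) (qr _ vq).
  rewrite !fIm ?normrN ?(qs v (ltW v0)) //.
  rewrite (_ : \int[mu]_x sin (- _ * _) = - \int[mu]_x sin (Num.sqrt v * X x)).
    rewrite subrr mul0r.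
    by under [X in series X]eq_fun do rewrite -sgn.
  have isin : mu.-integrable setT (EFin \o (fun x => sin (Num.sqrt v * X x))).
    apply: integrable_norm_le1 => [|x]; last by rewrite ler_norml sin_geN1 sin_le1.
    apply: measurableT_comp; first exact: measurable_sin.
    exact: measurable_funM.
  have := @RintegralZl _ _ _ mu setT _ (-1) measurableT isin.
  rewrite mulN1r => <-.
  by apply: eq_Rintegral => x _; rewrite mulNr sinN mulN1r.
Qed.

Lemma cosh_transform_step d (T : measurableType d) (R : realType)
    (mu : probability T R) (X : T -> R) (rho : \bar R) (f : R[i] -> R[i]) (b : R) :
  measurable_fun setT X -> analytic_on (cdisc 0 rho) f ->
  0 < b -> (b%:E < rho)%E ->
  (forall u, 0 <= u -> u < b -> cosh_transform_at mu X f u) ->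
  exists e, 0 < e /\ forall u, b <= u -> u < b + e -> cosh_transform_at mu X f u.
Proof.
move=> mX fA b0 b_rho Hb.
have [|c [r [r0 H]]] := @analytic_imag_mean _ _ _ b fA.
  by rewrite ger0_norm ?ltW.
pose q := Num.min r b.
have q0 : 0 < q by rewrite lt_min r0.
(* The backward expansion is used only for [v < q], so that [b - v] stays in the known range; the
   coefficients found there serve forward on the whole radius [r]. The endpoint [u = b] is the case
   [w = 0]. *)
exists r; split=> // u bu ur; pose w := u - b.
have w0 : 0 <= w by rewrite subr_ge0.
have wr : `|w| < r by rewrite ger0_norm // ltrBlDl.
have -> : u = b + w by rewrite addrC subrK.
have cP P v : coordinate P -> 0 < v -> v < q ->
    series (fun j => (-1) ^+ j * P (c j) * v ^+ j) @ \oo --> P (imag_mean f (b - v)).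
  move=> coP v0; rewrite lt_min => /andP[vr _].
  have : `|- v| < r by rewrite normrN gtr0_norm.
  move=> /(H P _ coP); rewrite (_ : (fun n => _ * (- v) ^+ n) =
    fun j => (-1) ^+ j * P (c j) * v ^+ j) //.
  by apply/funext => n; rewrite [(- v) ^+ n]exprNn mulrCA mulrA.
have Hv v : 0 < v -> v < q -> cosh_transform_at mu X f (b - v).
  move=> v0; rewrite lt_min => /andP[_ vb].
  by apply: Hb; [rewrite subr_ge0 ltW|rewrite ltrBlDr ltrDl].
split.
- pose m j x := coshD j b (X x) / j`!%:R.
  have mm j : measurable_fun setT (m j).
    by apply: measurable_funM => //; apply: measurableT_comp => //; exact: measurable_coshD.
  have m0 j x : 0 <= m j x by rewrite divr_ge0 // coshD_ge0 // ltW.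
  apply: (integral_power_series w0 mm m0 (c := fun n => complex.Re (c n))).
  + apply: (@integral_alternating_coef _ _ _ mu (fun v x => coshD 0 (b - v) (X x)) m
      (fun v => complex.Re (imag_mean f (b - v))) _ q) => //.
    * by move=> v; apply: measurableT_comp => //; exact: measurable_coshD.
    * move=> n v x v0; rewrite lt_min => /andP[_ vb].
      by apply: altrem_coshD_ge0; exact: ltW.
    * by move=> v v0 vq; have [] := Hv v v0 vq.
    * by move=> v v0 vq; exact: cP (coordinate_Re R) v0 vq.
  + by move=> x; exact: cvg_series_coshD.
  + exact: H (coordinate_Re R) wr.
- apply: cvg_series_zero_coef (H _ _ (coordinate_Im R) wr).
  apply: (alternating_series_coef0 q0) => v v0 vq.
  have [_ <-] := Hv v v0 vq; exact: cP (coordinate_Im R) v0 vq.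
Qed.

(** Were the identity to fail at [u], the infimum of the nonnegative points of failure would be
    positive by the local result at 0 and at most [s]; the identity would hold below it, and the
    extension step would push it strictly beyond, a contradiction. *)
Lemma cosh_transform d (T : measurableType d) (R : realType)
    (mu : probability T R) (X : T -> R) (rho : \bar R) (f : R[i] -> R[i]) (s : R) :
  measurable_fun setT X -> analytic_on (cdisc 0 rho) f ->
  0 < s -> (s%:E < rho)%E ->
  (forall t, `|t| < s -> complex.Re (f t%:C) = \int[mu]_x cos (t * X x)) ->
  (forall t, `|t| < s -> complex.Im (f t%:C) = \int[mu]_x sin (t * X x)) ->
  forall u, 0 <= u -> u <= s -> cosh_transform_at mu X f u.
Proof.
move=> mX fA s0 s_rho fRe fIm u u0 us; apply: contrapT => Hu.
have [e0 [e0_gt0 He0]] := cosh_transform_near0 mX fA s0 s_rho fRe fIm.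
pose B := [set v | 0 <= v /\ ~ cosh_transform_at mu X f v].
have Bu : B u by [].
have B_nonempty : B !=set0 by exists u.
have lbB : lbound B e0.
  by move=> v [v0 Hv]; rewrite leNgt; apply/negP => /(He0 _ v0).
have B_inf : has_inf B by split=> //; exists e0.
have b0 : 0 < inf B := lt_le_trans e0_gt0 (lb_le_inf B_nonempty lbB).
have bs : inf B <= s := le_trans (ge_inf B_inf.2 Bu) us.
have b_rho : ((inf B)%:E < rho)%E by apply: le_lt_trans s_rho; rewrite lee_fin.
have Hb v : 0 <= v -> v < inf B -> cosh_transform_at mu X f v.
  move=> v0 vb; apply: contrapT => Hv.
  by have := ge_inf B_inf.2 (conj v0 Hv : B v); rewrite leNgt vb.
have [e [e_gt0 He]] := cosh_transform_step mX fA b0 b_rho Hb.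
have : inf B + e <= inf B.
  apply: lb_le_inf => // v [v0 Hv]; rewrite leNgt; apply/negP => vbe.
  by apply: Hv; have [/(Hb _ v0)//|bv] := ltP v (inf B); exact: He.
by rewrite leNgt ltrDl e_gt0.
Qed.

(** * Hyperbolic inequalities, tail probability and integration over [[0, s]] *)

(** By duplication, [sinh y = 2 sinh (y / 2) cosh (y / 2)]: a weak bound on the first factor
    suffices, since the second exceeds 1 strictly. This makes the denominator of the final
    inequality positive. *)
Lemma sinh_gt (R : realType) (y : R) : 0 < y -> y < sinh y.
Proof.
move=> y0; pose g : R -> R := fun z => expR z - expR (- z) - 2 * z.
have dg (z : R) : is_derive z 1 g (expR z + expR (- z) - 2).
  have -> : g = (@expR R - (@expR R \o -%R)) - 2 \*: @id R.
    by apply/funext => u; rewrite /g !fctE /GRing.scale.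
  have dn := is_derive1_comp (is_derive_expR (- z)) (is_deriveNid z 1).
  have := is_deriveB (is_deriveB (is_derive_expR z) dn) (is_deriveZ 2 (is_derive_id z 1)).
  by move/is_derive_eq; apply; rewrite /GRing.scale /= mulrN1 opprK mulr1.
have z0 : 0 < y / 2 by rewrite divr_gt0.
have gz : 0 <= g (y / 2).
  apply: (ge0_of_derive_ge0 dg _ _ (ltW z0) (lexx _)).
    by move=> z _ _; have := expR_ge1Dx z; have := expR_ge1Dx (- z); lra.
  by rewrite /g oppr0 mulr0 !subrr.
have c2 : 2 < expR (y / 2) + expR (- (y / 2)).
  have z_neq0 : y / 2 != 0 by rewrite gt_eqF.
  have Nz_neq0 : - (y / 2) != 0 by rewrite oppr_eq0.
  by have := expR_gt1Dx z_neq0; have := expR_gt1Dx Nz_neq0; lra.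
have -> : sinh y = (expR (y / 2) - expR (- (y / 2))) * (expR (y / 2) + expR (- (y / 2))) / 2.
  rewrite /sinh -subr_sqr -!expRM_natl; congr ((expR _ - expR _) / 2); lra.
move: gz c2; rewrite /g; set p := expR (y / 2); set q := expR (- (y / 2)) => gz c2.
rewrite ltr_pdivlMr //.
apply: (@lt_le_trans _ _ (y * (p + q))); first by rewrite ltr_pM2l.
by rewrite ler_pM2r //; lra.
Qed.

Lemma coshD0_le (R : realType) (w a x : R) :
  0 <= w -> `|a| <= `|x| -> coshD 0 w a <= coshD 0 w x.
Proof.
have absE y : coshD 0 w y = coshD 0 w `|y|.
  have [y0|y0] := leP 0 y; first by rewrite ger0_norm.
  by rewrite ltr0_norm // /coshD !expr0 !mulrN opprK addrC.
move=> w0 ax; rewrite (absE a) (absE x) /coshD !expr0 !mul1r ler_pM2r //.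
have := normr_ge0 a; move: `|a| `|x| ax => p q pq p0.
have h : 1 <= expR (w * p) by rewrite -expR0 ler_expR mulr_ge0.
have k : expR (w * p) <= expR (w * q) by rewrite ler_expR ler_wpM2l.
have e1 := expRxMexpNx_1 (w * p); have e2 := expRxMexpNx_1 (w * q).
have n1 := expR_ge0 (- (w * p)); have n2 := expR_ge0 (- (w * q)).
have i1 : expR (- (w * p)) <= 1 by rewrite expR_le1 oppr_le0 mulr_ge0.
have i2 : expR (- (w * q)) <= 1.
  by rewrite expR_le1 oppr_le0 mulr_ge0 // (le_trans p0).
move: (expR (w * p)) (expR (w * q)) (expR (- (w * p))) (expR (- (w * q)))
  h k e1 e2 n1 n2 i1 i2 => a1 a2 b1 b2 h k e1 e2 n1 n2 i1 i2.
(* As [a1 * b1 = a2 * b2 = 1], this product expands to [(a2 + b2) - (a1 + b1)]. *)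
have : 0 <= (a2 - a1) * (1 - b1 * b2).
  by rewrite mulr_ge0 ?subr_ge0 // mulr_ile1.
have -> : (a2 - a1) * (1 - b1 * b2) = a2 - a1 - b1 * (a2 * b2) + b2 * (a1 * b1).
  by ring.
rewrite e1 e2; lra.
Qed.

Lemma coshD_at0 (R : realType) (w : R) : coshD 0 w 0 = 1.
Proof. by rewrite /coshD !expr0 mulr0 oppr0 expR0 !mul1r; field. Qed.

(** A Markov-type bound: [cosh (u X)] dominates [1 + (cosh (u a) - 1) * \1_E] pointwise, and [mu]
    has total mass 1. *)
Lemma cosh_markov d (T : measurableType d) (R : realType)
    (mu : probability T R) (X : T -> R) (E : set T) (a u l : R) :
  measurable_fun setT X -> measurable E -> (forall x, E x -> `|a| <= `|X x|) ->
  0 <= u -> (\int[mu]_x (coshD 0 u (X x))%:E = l%:E)%E ->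
  (coshD 0 u a - 1) * fine (mu E) <= l - 1.
Proof.
move=> mX mE Ea u0 ul; rewrite lerBrDl -lee_fin -ul.
have C0 : 0 <= coshD 0 u a - 1.
  by rewrite subr_ge0 -(coshD_at0 u) coshD0_le // normr0.
have -> : ((1 + (coshD 0 u a - 1) * fine (mu E))%:E =
    \int[mu]_x (1 + (coshD 0 u a - 1) * \1_E x)%:E)%E.
  under eq_integral do rewrite EFinD EFinM.
  rewrite ge0_integralD //; last 2 first.
  - by move=> x _; rewrite lee_fin mulr_ge0.
  - by apply: measurable_funeM; exact: measurableT_comp.
  rewrite ge0_integralZl_EFin //; last exact: measurableT_comp.
  rewrite integral_indic // setIT EFinD EFinM fineK ?fin_num_measure //.
  congr (_ + _)%E.
  rewrite (eq_integral (cst 1%E)) // integral_cst // mul1e.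
  exact/esym/probability_setT.
apply: ge0_le_integral => //.
- by move=> x _; rewrite lee_fin addr_ge0 // mulr_ge0.
- apply: measurableT_comp => //; apply: measurable_funD => //.
  exact: measurable_funM.
- apply: measurableT_comp => //; apply: measurableT_comp => //.
  exact: measurable_coshD.
move=> x _; rewrite lee_fin indicE; have [xE|xE] := boolP (x \in E).
  by rewrite mulr1 addrC subrK coshD0_le // Ea //; exact/set_mem.
by rewrite mulr0 addr0 -(coshD_at0 u) coshD0_le // normr0.
Qed.

(** By right-continuity of [F] the increment [F a - F (- a)] is the mass of the interval open at
    [- a] and closed at [a]; the tail thus contains [- a] but not [a]. *)
Lemma stieltjes_measure_tail (R : realType) (F : cumulativeBounded (0 : R) (1 : R)) (a : R) :
  0 < a ->
  lebesgue_stieltjes_measure F (~` `]- a, a]%classic) = (1 - F a + F (- a))%:E.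
Proof.
move=> a0; have aa : - a <= a by lra.
rewrite (probability_setC (lebesgue_stieltjes_measure F)); last first.
  by apply: sub_sigma_algebra; exact: is_ocitv.
rewrite /= /lebesgue_stieltjes_measure /= /measure_extension.
rewrite measurable_mu_extE /=; last exact: is_ocitv.
by rewrite wlength_itv_bnd // -!EFinB opprB addrA addrAC.
Qed.

Lemma Rintegral_coshD (R : realType) (A s p : R) : 0 < A -> 0 < s ->
  \int[@lebesgue_measure R]_(u in `[0, s]) ((coshD 0 u A - 1) * p) =
  p * (sinh (A * s) / A - s).
Proof.
(* An antiderivative: [coshD 1 u A] is [A * sinh (u * A)], and [coshD 2 u A] is [A ^+ 2] times the
   hyperbolic cosine. *)
move=> A0 s0; pose G u := p * (coshD 1 u A / A ^+ 2 - u).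
have dC n (u : R) := is_derive_coshD n u A.
have dG (u : R) : is_derive u 1 G ((coshD 0 u A - 1) * p).
  have -> : G = p \*: ((A ^+ 2)^-1 \*: (@coshD R 1)^~ A - @id R).
    by apply/funext => v; rewrite /G !fctE /GRing.scale /= [_ / _]mulrC.
  have := is_deriveZ p (is_deriveB (is_deriveZ (A ^+ 2)^-1 (dC 1%N u)) (is_derive_id u 1)).
  move/is_derive_eq; apply; rewrite /GRing.scale /= /coshD !expr0 sqrrN.
  by field; rewrite gt_eqF.
have cont (g dg : R -> R) : (forall u : R, is_derive u 1 g (dg u)) -> continuous g.
  by move=> dg' u; apply/differentiable_continuous/derivable1_diffP; have [] := dg' u.
have cG := cont _ _ dG.
rewrite /Rintegral (@continuous_FTC2 _ _ G) //.
- rewrite /= /G /sinh /coshD !expr1 mul0r oppr0 expR0 [s * A]mulrC.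
  by field; rewrite gt_eqF.
- apply: continuous_subspaceT => u; apply: cvgM; last exact: cvg_cst.
  by apply: cvgB; [exact: (cont _ _ (dC 0%N))|exact: cvg_cst].
- split=> [u _||].
  + by have [] := dG u.
  + exact: cvg_at_right_filter (cG _).
  + exact: cvg_at_left_filter (cG _).
- by move=> u _; rewrite derive1E; have [] := dG u.
Qed.

Unset Implicit Arguments.

Theorem theorem2p2 (R : realType) (rho : \bar R) (rho_gt0 : (0 < rho)%E)
    (F : cumulativeBounded (0 : R) (1 : R)) (f : R[i] -> R[i])
    (f_analytic : analytic_on (cdisc 0 rho) f)
    (f_charf : forall t : R, (`|t|%:E < rho)%E -> f t%:C = charf F t)
    (A : R) (A_gt0 : 0 < A) (s : R) (s_gt0 : 0 < s) (s_lt : (s%:E < rho)%E) :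
  (1 - F A + F (- A))%:C <=
    cintegral (@lebesgue_measure R) `[0, s]
      (fun u : R => (f (0 +i* u) + f (0 -i* u)) / 2 - 1)
    / (s * (sinh (A * s) / (A * s) - 1))%:C.
Proof.
set mu : probability _ R := lebesgue_stieltjes_measure F.
pose X : measurableTypeR R -> R := id.
have mX : measurable_fun setT X by exact: measurable_id.
have charfE t : `|t| < s -> f t%:C = charf F t.
  by move=> ts; apply: f_charf; apply: lt_trans s_lt; rewrite lte_fin.
have H u : 0 <= u -> u <= s -> cosh_transform_at mu X f u.
  apply: (cosh_transform mX f_analytic s_gt0 s_lt) => t ts; by rewrite charfE.
pose E : set (measurableTypeR R) := ~` `]- A, A]%classic.
have mE : measurable E.
  by apply: measurableC; apply: sub_sigma_algebra; exact: is_ocitv.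
have EA x : E x -> `|A| <= `|X x|.
  move=> /= /negP; rewrite in_itv /= negb_and -leNgt -ltNge => xA.
  rewrite gtr0_norm // /X; case/orP: xA => xA.
    by rewrite -normrN ler_normr; apply/orP; left; lra.
  by rewrite ler_normr ltW.
set p := 1 - F A + F (- A).
have pE : fine (mu E) = p.
  by rewrite (_ : mu E = p%:E) //; exact: stieltjes_measure_tail.
pose h u := complex.Re (imag_mean f u).
have hge u : 0 <= u -> u <= s -> (coshD 0 u A - 1) * p <= h u - 1.
  by move=> u0 us; rewrite -pE; apply: (cosh_markov mX mE EA u0); have [] := H u u0 us.
have coshC (u y : R) : coshD 0 u y = coshD 0 y u by rewrite /coshD !expr0 [u * y]mulrC.
(* Monotonicity makes [h] measurable and bounded on [[0, s]], hence integrable. It follows from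
   [coshD0_le] once the two arguments of the hyperbolic cosine are exchanged. *)
have hmono u v : 0 <= u -> u <= v -> v <= s -> h u <= h v.
  move=> u0 uv vs; have v0 := le_trans u0 uv.
  rewrite -lee_fin -(H u u0 (le_trans uv vs)).1 -(H v v0 vs).1.
  have mC w : measurable_fun setT (fun x => (coshD 0 w (X x))%:E).
    apply: measurableT_comp => //; apply: measurableT_comp => //.
    exact: measurable_coshD.
  apply: ge0_le_integral => // [x _|x _]; rewrite lee_fin; first exact: coshD_ge0.
  have Ca w : 0 <= w -> coshD 0 w (X x) = coshD 0 `|X x| w.
    by rewrite coshC /coshD !expr0; case: (leP 0 (X x)) => x0 w0;
      [rewrite ger0_norm|rewrite ltr0_norm // !mulNr opprK addrC].
  by rewrite !Ca // coshD0_le // !ger0_norm.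
have mI : measurable (`[0, s]%classic : set R) by exact: measurable_itv.
have fin_I : (lebesgue_measure ([set` `[0%R, s]] : set R) < +oo)%E.
  by rewrite lebesgue_measure_itv /=; case: ifP => _; rewrite ?ltry.
have inI u : [set` `[0, s]] u -> 0 <= u /\ u <= s.
  by rewrite /= in_itv /= => /andP.
have int_h : (@lebesgue_measure R).-integrable `[0, s] (EFin \o (fun u => h u - 1)).
  apply: measurable_bounded_integrable => //.
    apply: measurable_funB => //.
    (* Clamping the argument to [[0, s]] gives a function that is nondecreasing on the whole
       line. *)
    pose g u := h (Num.min (Num.max u 0) s).
    apply: (eq_measurable_fun g).
      move=> u /set_mem/inI [u0 us]; rewrite /g max_l // min_l //.
    apply: nondecreasing_measurable => // u v uv.
    apply: hmono.
    - by rewrite le_min le_max lexx orbT ltW.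
    - by rewrite le_min !ge_min ge_max !le_max uv !lexx !orbT.
    - by rewrite ge_min lexx orbT.
  (* By monotonicity [h u] lies between [h 0] and [h s]; the 1 accounts for the subtracted
     constant. *)
  exists (`|h 0| + `|h s| + 1); split; rewrite ?num_real // => K hK u /= /inI [u0 us].
  apply: le_trans (ltW hK).
  have h1 := hmono 0 u (lexx 0) u0 us; have h2 := hmono u s u0 us (lexx s).
  have h3 := ler_norm (h s); have h4 := ler_norm (- h 0); rewrite normrN in h4.
  have h5 := normr_ge0 (h s); have h6 := normr_ge0 (h 0).
  by rewrite ler_norml; apply/andP; split; lra.
have int_g : (@lebesgue_measure R).-integrable `[0, s]
    (EFin \o (fun u => (coshD 0 u A - 1) * p)).
  apply: continuous_compact_integrable; first exact: segment_compact.
  apply: continuous_subspaceT => u; apply: cvgM; last exact: cvg_cst.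
  by apply: cvgB; [exact: continuous_coshD|exact: cvg_cst].
have le_int : p * (sinh (A * s) / A - s) <=
    \int[@lebesgue_measure R]_(u in `[0, s]) (h u - 1).
  rewrite -Rintegral_coshD //; apply: le_Rintegral => // u /inI [u0 us].
  exact: hge.
have D0 : 0 < s * (sinh (A * s) / (A * s) - 1).
  rewrite mulr_gt0 // subr_gt0 ltr_pdivlMr ?mulr_gt0 // mul1r.
  by apply: sinh_gt; rewrite mulr_gt0.
(* The imaginary part of the mean vanishes on [[0, s]], so the complex integral is real and the
   claim becomes an inequality of real numbers. *)
have -> : cintegral (@lebesgue_measure R) `[0, s]
      (fun u : R => (f (0 +i* u) + f (0 -i* u)) / 2 - 1) =
    (\int[@lebesgue_measure R]_(u in `[0, s]) (h u - 1))%:C.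
  rewrite /cintegral; congr (_ +i* _).
    by apply: eq_Rintegral => u _; rewrite (coordinateB (coordinate_Re R)).
  rewrite (@eq_Rintegral _ _ _ _ _ (cst 0)) ?Rintegral_cst ?mul0r //.
  move=> u /set_mem/inI [u0 us].
  by rewrite (coordinateB (coordinate_Im R)) (H u u0 us).2 subr0.
rewrite -fmorphV -rmorphM /= lecR ler_pdivlMr //.
apply: le_trans le_int; rewrite le_eqVlt; apply/orP; left; apply/eqP.
by field; rewrite !gt_eqF.
Qed.
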